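(* (i) For any orthonormal basis $\{p_1,\dots,p_7\}$ of $\mathbb{R}^7$ and all $a,b\in\mathbb{R}^7$, $$a\times b=\frac12\sum_{k=1}^7[a,b]_{p_k}.$$ (ii) For all $a,b\in\mathbb{R}^7$, $$a\times b=\frac72\int_{S^6}[a,b]_p\;d\sigma(p),$$ where $d\sigma$ denotes the normalized $SO(7)$-invariant probability measure on $S^6$.
   Context: Let $\{e_1,\dots,e_7\}$ be the standard orthonormal basis of $\mathbb{R}^7$ with Euclidean inner product $\langle\cdot,\cdot\rangle$, dual basis $\omega^1,\dots,\omega^7$, and $\omega^{ijk}=\omega^i\wedge\omega^j\wedge\omega^k$. Let $$\Phi=\omega^{123}+\omega^{145}+\omega^{167}+\omega^{246}-\omega^{257}-\omega^{347}-\omega^{356},$$ and let $\times$ be the bilinear cross product on $\mathbb{R}^7$ characterized by $\langle u\times v,w\rangle=\Phi(u,v,w)$. For a unit vector $p\in S^6\subset\mathbb{R}^7$, the directional Vidinli algebra $\mathbb{V}_{7,p}=(\mathbb{R}^7,\veebar_p)$ has the product $$a\veebar_p b=\langle a,p\rangle b+\langle b,p\rangle a-\langle a,b\rangle p+\langle p,a\times b\rangle p,$$ and its commutator is $[a,b]_p=a\veebar_p b-b\veebar_p a=2\langle p,a\times b\rangle p$. *)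

(* Defs.v *)
From HB Require Import structures.
From mathcomp Require Import all_boot all_order all_algebra.
From mathcomp Require Import all_classical all_reals all_analysis.
From mathcomp Require Import ring.
Set Implicit Arguments.
Unset Strict Implicit.
Unset Printing Implicit Defensive.
Import Order.TTheory GRing.Theory Num.Theory.
Import numFieldNormedType.Exports.
Local Open Scope classical_set_scope.
Local Open Scope ring_scope.

(* The norm `|u| that the library puts on 'rV[R]_n is the sup norm, so the
   Euclidean structure is introduced separately. *)
Definition dotp (R : realType) (n : nat) (u v : 'rV[R]_n) : R :=
  \sum_(i < n) u 0 i * v 0 i.

Definition orthonormal_basis (R : realType) (n : nat)
    (p : n.-tuple 'rV[R]_n) : Prop :=
  basis_of fullv p /\
  forall i j : 'I_n, dotp (tnth p i) (tnth p j) = (i == j)%:R.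

(* The dual basis omega^1, ..., omega^7, with the usual indices 1, ..., 7:
   omega^k is the coordinate of (ordinal) index k - 1. *)
Definition omega (R : realType) (k : nat) (u : 'rV[R]_7) : R :=
  u 0 (inord k.-1).

(* Wedge product of three linear forms, with the determinant normalization
   (f ^ g ^ h)(u, v, w) = det of the matrix of values; in particular
   omega^{ijk}(e_i, e_j, e_k) = 1. *)
Definition wedge3 (R : realType) (V : Type) (f g h : V -> R) (u v w : V) : R :=
  \det (\matrix_(r < 3, c < 3)
          (tnth [tuple f; g; h] r) (tnth [tuple u; v; w] c)).

Definition omega3 (R : realType) (i j k : nat) : 'rV[R]_7 -> 'rV[R]_7 ->
    'rV[R]_7 -> R :=
  wedge3 (@omega R i) (@omega R j) (@omega R k).

Definition Phi (R : realType) (u v w : 'rV[R]_7) : R :=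
    omega3 1 2 3 u v w + omega3 1 4 5 u v w + omega3 1 6 7 u v w
  + omega3 2 4 6 u v w - omega3 2 5 7 u v w - omega3 3 4 7 u v w
  - omega3 3 5 6 u v w.

(* The coordinates of u x v are forced by <u x v, w> = Phi(u, v, w) at
   w = e_k; see crossP and cross_unique for the characterization. *)
Definition cross (R : realType) (u v : 'rV[R]_7) : 'rV[R]_7 :=
  \row_k Phi u v (delta_mx 0 k).

Section CrossCharacterization.
Variable R : realType.
Implicit Types u v w x : 'rV[R]_7.

Lemma dotp_delta n (x : 'rV[R]_n) k : dotp x (delta_mx 0 k) = x 0 k.
Proof.
rewrite /dotp (bigD1 k) //= mxE !eqxx mulr1 big1 ?addr0 // => i ik.
by rewrite mxE (negbTE ik) andbF mulr0.
Qed.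

Lemma omega3E i j k u v w : omega3 i j k u v w =
  omega i u * (omega j v * omega k w - omega k v * omega j w)
  - omega i v * (omega j u * omega k w - omega k u * omega j w)
  + omega i w * (omega j u * omega k v - omega k u * omega j v).
Proof.
rewrite /omega3 /wedge3 (expand_det_row _ ord0) !big_ord_recl big_ord0.
rewrite /cofactor !(expand_det_row _ ord0) !big_ord_recl !big_ord0.
rewrite /cofactor !det_mx11 !mxE /= !(tnth_nth (omega i)) !(tnth_nth u) /=.
by rewrite /bump /=; ring.
Qed.

Lemma omega3_sum i j k u v w :
  omega3 i j k u v w =
  \sum_(l < 7) omega3 i j k u v (delta_mx 0 l) * w 0 l.
Proof.
have om m : omega m w = \sum_(l < 7) omega m (delta_mx 0 l : 'rV[R]_7) * w 0 l.
  rewrite /omega -(dotp_delta w) /dotp; apply: eq_bigr => l _.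
  by rewrite mulrC !mxE !eqxx /= eq_sym.
transitivity (\sum_(l < 7)
  ((omega i u * omega j v - omega i v * omega j u)
     * (omega k (delta_mx 0 l : 'rV[R]_7) * w 0 l)
   + ((omega i v * omega k u - omega i u * omega k v)
     * (omega j (delta_mx 0 l : 'rV[R]_7) * w 0 l)
   + (omega j u * omega k v - omega k u * omega j v)
     * (omega i (delta_mx 0 l : 'rV[R]_7) * w 0 l)))).
  by rewrite !big_split /= -!mulr_sumr -!om omega3E; ring.
by apply: eq_bigr => l _; rewrite omega3E; ring.
Qed.

Lemma crossP u v w : dotp (cross u v) w = Phi u v w.
Proof.
rewrite /Phi !(omega3_sum _ _ _ u v w) -!sumrN -!big_split /=.
by apply: eq_bigr => l _; rewrite mxE /Phi; ring.
Qed.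

Lemma cross_unique u v x :
  (forall w, dotp x w = Phi u v w) -> x = cross u v.
Proof. by move=> xP; apply/rowP => k; rewrite mxE -xP dotp_delta. Qed.

End CrossCharacterization.

Definition vidinli (R : realType) (p a b : 'rV[R]_7) : 'rV[R]_7 :=
  dotp a p *: b + dotp b p *: a - dotp a b *: p + dotp p (cross a b) *: p.

Definition vidinli_comm (R : realType) (p a b : 'rV[R]_7) : 'rV[R]_7 :=
  vidinli p a b - vidinli p b a.

Definition S6 (R : realType) : set 'rV[R]_7 := [set p | dotp p p = 1].

Definition SO (R : realType) (n : nat) : set 'M[R]_n :=
  [set Q | Q *m Q^T = 1%:M /\ \det Q = 1].

Notation borel_rV7 R := (g_sigma_algebraType (@open 'rV[R]_7)).

(* Borel probability measures on S^6 are represented by the Borel probability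
   measures on R^7 of full mass on S^6. A matrix Q acts on row vectors by
   p |-> p *m Q; as SO(7) is stable under transposition, this gives the same
   set of maps as the left action on column vectors. The conditions below
   determine sigma uniquely. *)
Definition SO7_invariant_probability_on_S6 (R : realType)
    (sigma : probability (borel_rV7 R) R) : Prop :=
  sigma (@S6 R) = 1%E /\
  forall Q : 'M[R]_7, SO Q ->
  forall A : set (borel_rV7 R), measurable A ->
    sigma [set p : borel_rV7 R | A ((p : 'rV[R]_7) *m Q)] = sigma A.

Definition rV_integral (d : measure_display) (T : measurableType d)
    (R : realType) (n : nat) (mu : {measure set T -> \bar R}) (D : set T)
    (f : T -> 'rV[R]_n) : 'rV[R]_n :=
  \row_j (\int[mu]_(x in D) f x 0 j)%R.

(* Main.v *)
Require Import Defs.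
From HB Require Import structures.
From mathcomp Require Import all_boot all_order all_algebra.
From mathcomp Require Import all_classical all_reals all_analysis.
From mathcomp Require Import measurable_realfun ring.
Set Implicit Arguments.
Unset Strict Implicit.
Unset Printing Implicit Defensive.
Import Order.TTheory GRing.Theory Num.Theory.
Import numFieldNormedType.Exports.
Local Open Scope classical_set_scope.
Local Open Scope ring_scope.

(** The commutator is [a, b]_p = 2 <p, a x b> p: the first three terms of the
    product are symmetric in a and b, the last one is antisymmetric
    ([vidinli_commE]). With c = a x b, both parts of the theorem therefore say
    that averaging the rank-one operators c |-> <p, c> p gives a multiple of
    the identity.

    For an orthonormal basis, the sum of the <p_k, c> p_k is c
    ([orthonormal_expansion]), and the factor 2 is cancelled by 1/2.

    On the sphere, the average of <p, c> p is determined by the second moments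
    E[p_i p_j], and these equal 1/7 if i = j and 0 otherwise ([second_moment]).
    Indeed, the integral of an even function is invariant under the whole group
    O(7), and not only under SO(7), because -1 has determinant -1 in dimension 7
    ([integral_O]). The reflection p_i |-> -p_i kills E[p_i p_j] for j <> i; the
    transposition of two coordinates shows that all E[p_i^2] are equal; and
    their sum is E[<p, p>] = 1. The factor 2/7 which results is cancelled by
    7/2.

    The analytic input is that continuous functions are Borel and, the sphere
    being compact, integrable on it ([continuous_integrable_S6]), and that the
    invariance of sigma on Borel sets passes to integrals ([integral_SO]). *)

(** * The commutator of the directional product *)

Lemma dotpC (R : realType) n (u v : 'rV[R]_n) : dotp u v = dotp v u.
Proof. by apply: eq_bigr => i _; rewrite mulrC. Qed.

Lemma dotpE (R : realType) n (u v : 'rV[R]_n) : dotp u v = (u *m v^T) 0 0.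
Proof. by rewrite mxE; apply: eq_bigr => i _; rewrite mxE. Qed.

Lemma crossC (R : realType) (u v : 'rV[R]_7) : cross v u = - cross u v.
Proof. by apply/rowP => k; rewrite !mxE /Phi !omega3E; ring. Qed.

Lemma vidinli_commE (R : realType) (p a b : 'rV[R]_7) :
  vidinli_comm p a b = (2 * dotp p (cross a b)) *: p.
Proof.
rewrite /vidinli_comm /vidinli (dotpC b a) (crossC a b).
have -> : dotp p (- cross a b) = - dotp p (cross a b).
  by rewrite !dotpE linearN mulmxN mxE.
by apply/rowP => k; rewrite !mxE; ring.
Qed.

(** The matrix P of rows p_k satisfies P P^T = 1, hence also P^T P = 1, and the
    expansion is the identity c P^T P = c read row by row. *)
Lemma orthonormal_expansion (R : realType) n (p : n.-tuple 'rV[R]_n)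
    (c : 'rV[R]_n) :
  orthonormal_basis p -> \sum_(k < n) dotp (tnth p k) c *: tnth p k = c.
Proof.
move=> [_ p_on]; pose P := \matrix_k tnth p k.
have PPT : P *m P^T = 1%:M.
  apply/matrixP => i j; rewrite !mxE -p_on.
  by apply: eq_bigr => k _; rewrite !mxE.
rewrite -[RHS]mulmx1 -(mulmx1C PPT) mulmxA [RHS]mulmx_sum_row.
apply: eq_bigr => k _; rewrite rowK dotpC /dotp mxE; congr (_ *: _).
by apply: eq_bigr => i _; rewrite !mxE.
Qed.

(** * Borel functions and the topology of the sphere *)

Lemma continuous_mx (R : realType) (T : topologicalType) m n
    (f : T -> 'M[R]_(m, n)) :
  (forall i j, continuous (fun x => f x i j)) -> continuous f.
Proof.
move=> cf x; apply/cvg_mx_entourageP => A entA.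
suff : \forall y \near x, forall i j, (f x i j, f y i j) \in A by [].
apply: filter_forall => i; apply: filter_forall => j.
have h : \forall y \near x, A (f x i j, f y i j).
  by have /cvg_entourageP/(_ A entA) := cf i j x.
by apply: filterS h => y Ay; rewrite inE.
Qed.

Lemma continuous_bigsum (R : realType) (T : topologicalType) (I : Type)
    (s : seq I) (F : I -> T -> R) :
  (forall i, continuous (F i)) -> continuous (fun x => \sum_(i <- s) F i x).
Proof. by move=> cF; apply: continuous_big => // x; exact: add_continuous. Qed.

Lemma continuous_coordM (R : realType) n (i j : 'I_n) :
  continuous (fun p : 'rV[R]_n => p 0 i * p 0 j).
Proof. by move=> x; apply: continuousM; exact: coord_continuous. Qed.

Lemma continuous_dotpp (R : realType) n :
  continuous (fun p : 'rV[R]_n => dotp p p).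
Proof. by apply: continuous_bigsum => i; exact: continuous_coordM. Qed.

Lemma continuous_mulmxr (R : realType) m n k (Q : 'M[R]_(n, k)) :
  continuous (fun p : 'M[R]_(m, n) => p *m Q).
Proof.
apply: continuous_mx => i j; under eq_fun do rewrite mxE.
apply: continuous_bigsum => l x.
by apply: continuousM; [exact: coord_continuous | exact: cst_continuous].
Qed.

Lemma continuous_borel (R : realType) (f : 'rV[R]_7 -> R) :
  continuous f -> measurable_fun [set: borel_rV7 R] f.
Proof.
move=> /continuousP cf; apply: (measurability _ (RGenOInfty.measurableE R)).
move=> _ [_ [a ->] <-]; rewrite setTI.
by apply: sub_gen_smallest; apply/cf/interval_open.
Qed.

Lemma mulmxr_borel (R : realType) (Q : 'M[R]_7) :
  measurable_fun [set: borel_rV7 R]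
    (fun p => (p : 'rV[R]_7) *m Q : borel_rV7 R).
Proof.
have /continuousP cQ := @continuous_mulmxr R 1 7 7 Q.
pose B : set (set (borel_rV7 R)) := @open 'rV[R]_7.
apply: (@measurability _ _ (borel_rV7 R) (borel_rV7 R) setT _ B) => //.
move=> _ [A oA <-]; rewrite setTI; apply: sub_gen_smallest; exact: cQ.
Qed.

Lemma orthogonal_dotpp (R : realType) n (Q : 'M[R]_n) (p : 'rV[R]_n) :
  Q *m Q^T = 1%:M -> dotp (p *m Q) (p *m Q) = dotp p p.
Proof. by move=> QQ; rewrite !dotpE trmx_mul mulmxA -(mulmxA p) QQ mulmx1. Qed.

Lemma closed_S6 (R : realType) : closed (@S6 R).
Proof.
apply: (@preimage_closed _ _ (fun p : 'rV[R]_7 => dotp p p) [set 1]).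
  by move=> x _; exact: continuous_dotpp.
exact: closed_eq.
Qed.

Lemma measurable_S6 (R : realType) : measurable (@S6 R : set (borel_rV7 R)).
Proof.
rewrite -[X in measurable X]setCK; apply: measurableC.
by apply: sub_gen_smallest; exact: closed_openC (@closed_S6 R).
Qed.

Lemma compact_S6 (R : realType) : compact (@S6 R).
Proof.
apply: bounded_closed_compact; last exact: closed_S6.
(* The norm is the sup norm: each coordinate has absolute value at most 1. *)
exists 1; split => // M M1 p /= pS; apply: le_trans (ltW M1).
rewrite [leLHS]mx_normrE; apply/bigmax_leP; split => // -[i j] _ /=.
rewrite (ord1 i) -(ler_pXn2r (n := 2)) ?nnegrE// expr1n real_normK ?num_real//.
rewrite -pS /dotp (bigD1 j)//= expr2 lerDl sumr_ge0// => k _.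
by rewrite -expr2 sqr_ge0.
Qed.

(** * Second moments of an invariant probability measure *)

Section SphereMoments.
Variables (R : realType) (sigma : probability (borel_rV7 R) R).
Hypothesis sigma_inv : SO7_invariant_probability_on_S6 sigma.

Lemma continuous_integrable_S6 (f : 'rV[R]_7 -> R) :
  continuous f -> sigma.-integrable (@S6 R) (EFin \o f).
Proof.
move=> cf; apply: measurable_bounded_integrable.
- exact: measurable_S6.
- by rewrite (_ : _ (@S6 R) = 1%E) ?ltry//; exact: sigma_inv.1.
- exact: measurable_funTS (continuous_borel cf).
- have : bounded_set (f @` @S6 R).
    apply: compact_bounded; apply: continuous_compact; last exact: compact_S6.
    exact: continuous_subspaceT.
  move=> [M [Mreal fM]]; exists M; split=> // N MN x Sx.
  by apply: (fM N MN); exists x.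
Qed.

(** Invariance says that the pushforward of sigma under p |-> p Q is sigma, and
    this map preserves the sphere, so this is a change of variables. *)
Lemma integral_SO (Q : 'M[R]_7) (f : 'rV[R]_7 -> R) : SO Q -> continuous f ->
  (\int[sigma]_(p in @S6 R) f (p *m Q))%R = (\int[sigma]_(p in @S6 R) f p)%R.
Proof.
move=> QSO cf; have [QQ _] := QSO; have mQ := mulmxr_borel Q.
have S6Q : (fun p : borel_rV7 R => (p : 'rV[R]_7) *m Q) @^-1` @S6 R = @S6 R.
  by apply/seteqP; split => p; rewrite /S6 /= orthogonal_dotpp.
rewrite /Rintegral -[in LHS]S6Q; congr fine.
rewrite -(integral_pushforward (f := EFin \o f) mQ).
- apply: eq_measure_integral => A mA _; exact: sigma_inv.2.
- by apply/measurable_EFinP; exact: continuous_borel.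
- rewrite S6Q; apply: (@continuous_integrable_S6 (fun p => f (p *m Q))) => x.
  by apply: continuous_comp; [exact: continuous_mulmxr | exact: cf].
- exact: measurable_S6.
Qed.

(** As det (-1) = -1 in odd dimension, Q or -Q is in SO(7), and an even function
    does not see the sign. This allows reflections and transpositions of
    coordinates, which are not rotations, as changes of variables. *)
Lemma integral_O (Q : 'M[R]_7) (f : 'rV[R]_7 -> R) :
  Q *m Q^T = 1%:M -> continuous f -> (forall p, f (- p) = f p) ->
  (\int[sigma]_(p in @S6 R) f (p *m Q))%R = (\int[sigma]_(p in @S6 R) f p)%R.
Proof.
move=> QQ cf fN.
have /eqP : \det Q ^+ 2 = 1.
  by rewrite expr2 -[X in _ * X]det_tr -det_mulmx QQ det1.
rewrite sqrf_eq1 => /orP[] /eqP dQ; first exact: integral_SO.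
rewrite -(@integral_SO (- Q) f) //; last first.
  split; first by rewrite linearN /= mulNmx mulmxN opprK.
  by rewrite -scaleN1r detZ dQ -signr_odd /= expr1 mulrNN mulr1.
by apply: eq_Rintegral => p _; rewrite mulmxN fN.
Qed.

Lemma integral_sum_S6 (I : Type) (s : seq I) (F : I -> 'rV[R]_7 -> R) :
  (forall i, continuous (F i)) ->
  (\int[sigma]_(p in @S6 R) \sum_(i <- s) F i p)%R =
  \sum_(i <- s) (\int[sigma]_(p in @S6 R) F i p)%R.
Proof.
move=> cF; elim: s => [|i s IHs].
  rewrite big_nil; under eq_Rintegral do rewrite big_nil.
  by rewrite Rintegral_cst ?mul0r//; exact: measurable_S6.
rewrite big_cons -IHs -RintegralD.
- by apply: eq_Rintegral => p _; rewrite big_cons.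
- exact: measurable_S6.
- exact: continuous_integrable_S6.
- by apply: continuous_integrable_S6; exact: continuous_bigsum.
Qed.

(** The reflection p_i |-> -p_i changes the sign of the integrand. *)
Lemma moment_offdiag (i j : 'I_7) : i != j ->
  (\int[sigma]_(p in @S6 R) (p 0 i * p 0 j))%R = 0.
Proof.
move=> ij; pose Q : 'M[R]_7 := diag_mx (\row_k (if k == i then -1 else 1)).
have QQ : Q *m Q^T = 1%:M.
  rewrite tr_diag_mx mulmx_diag -diag_const_mx; congr diag_mx.
  by apply/rowP => k; rewrite !mxE; case: ifP => _; ring.
have mN : (\int[sigma]_(p in @S6 R) (p 0 i * p 0 j))%R =
          - (\int[sigma]_(p in @S6 R) (p 0 i * p 0 j))%R.
  rewrite -[LHS](integral_O QQ (@continuous_coordM R 7 i j)) => [|p]; last first.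
    by rewrite !mxE mulrNN.
  rewrite -mulN1r -RintegralZl; first last.
  - exact: continuous_integrable_S6 (@continuous_coordM R 7 i j).
  - exact: measurable_S6.
  apply: eq_Rintegral => p _; rewrite mul_mx_diag !mxE eqxx eq_sym (negbTE ij).
  by ring.
by apply/eqP; rewrite -[_ == 0](@mulrn_eq0 _ _ 2) mulr2n {1}mN addNr.
Qed.

(** Exchange the coordinates i and j. *)
Lemma moment_diag (i j : 'I_7) :
  (\int[sigma]_(p in @S6 R) (p 0 i * p 0 i))%R =
  (\int[sigma]_(p in @S6 R) (p 0 j * p 0 j))%R.
Proof.
have QQ : (tperm_mx i j : 'M[R]_7) *m (tperm_mx i j)^T = 1%:M.
  by rewrite tr_tperm_mx -perm_mxM perm.tperm2 perm_mx1.
rewrite -(integral_O QQ (@continuous_coordM R 7 i i)) => [|p]; last first.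
  by rewrite !mxE mulrNN.
by apply: eq_Rintegral => p _; rewrite -xcolE !mxE perm.tpermL.
Qed.

Lemma second_moment (i j : 'I_7) :
  (\int[sigma]_(p in @S6 R) (p 0 i * p 0 j))%R = 7^-1 * (i == j)%:R.
Proof.
have [<-|/moment_offdiag ->] := eqVneq i j; last by rewrite mulr0.
have n7 : 7 != 0 :> R by rewrite pnatr_eq0.
rewrite mulr1; apply: (mulfI n7); rewrite divff//.
(* Seven times the common value of the diagonal moments is their sum, which is
   the integral of <p, p> = 1. *)
transitivity (\sum_(k < 7) (\int[sigma]_(p in @S6 R) (p 0 k * p 0 k))%R).
  rewrite (eq_bigr _ (fun k _ => moment_diag k i)) sumr_const card_ord.
  by rewrite mulr_natl.
rewrite -integral_sum_S6; last by move=> k; exact: continuous_coordM.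
rewrite (@eq_Rintegral _ _ _ _ _ (cst 1)); last by move=> p; rewrite inE.
rewrite Rintegral_cst; last exact: measurable_S6.
by rewrite (_ : _ (@S6 R) = 1%E) ?mulr1//; exact: sigma_inv.1.
Qed.

End SphereMoments.

(** * The cross product as an average of commutators *)

Theorem proposition3p18 (R : realType) :
  (forall p : 7.-tuple 'rV[R]_7, orthonormal_basis p ->
   forall a b : 'rV[R]_7,
     cross a b = 2^-1 *: \sum_(k < 7) vidinli_comm (tnth p k) a b)
  /\
  (forall sigma : probability (borel_rV7 R) R,
     SO7_invariant_probability_on_S6 sigma ->
   forall a b : 'rV[R]_7,
     cross a b =
       (7 / 2) *: rV_integral sigma (@S6 R) (fun p => vidinli_comm p a b)).
Proof.
have n2 : 2 != 0 :> R by rewrite pnatr_eq0.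
split=> [p p_on a b | sigma sigma_inv a b].
  under eq_bigr do rewrite vidinli_commE -scalerA.
  by rewrite -scaler_sumr orthonormal_expansion// scalerA mulVf// scale1r.
set c := cross a b; apply/rowP => j.
rewrite [RHS]mxE [in RHS]mxE.
(* The entry j of the integrand is 2 <p, c> p_j: expand <p, c> in coordinates. *)
transitivity (7 / 2 * \sum_(i < 7)
    (\int[sigma]_(p in @S6 R) (2 * c 0 i * (p 0 i * p 0 j)))%R); last first.
  rewrite -integral_sum_S6//; last first.
    move=> i x; apply: (@continuousM _ 'rV[R]_7 (fun=> 2 * c 0 i)).
      exact: cst_continuous.
    exact: continuous_coordM.
  congr (_ * _); apply: eq_Rintegral => p _.
  rewrite vidinli_commE mxE /dotp mulr_sumr mulr_suml.
  by apply: eq_bigr => i _; rewrite -/c; ring.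
rewrite (bigD1 j)//= big1 ?addr0 => [|i ij].
  rewrite RintegralZl; first last.
  - exact: continuous_integrable_S6 (@continuous_coordM R 7 j j).
  - exact: measurable_S6.
  by rewrite second_moment// eqxx mulr1; field.
rewrite RintegralZl; first last.
- exact: continuous_integrable_S6 (@continuous_coordM R 7 i j).
- exact: measurable_S6.
by rewrite second_moment// (negbTE ij) !mulr0.
Qed.
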